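(* Let $n\ge1$ and $\Phi\in\mathcal X(\mathbf S^n,\mathbf S)_J$. (1) When $\Phi\nleq h$, it can be uniquely written as a polynomial of the form $\Phi=\bigwedge_{i=1}^n p_i^{\epsilon_i}$ with $(\epsilon_1,\dots,\epsilon_n)\in\{0,1\}^n$. (2) When $\Phi\le h$, it can be uniquely written as a polynomial of the form $\Phi=\left(\bigwedge_{i=1}^n p_i^{\epsilon_i}\right)\wedge h$ with $(\epsilon_1,\dots,\epsilon_n)\in\{0,1\}^n$.
   Context: $S=\{0,h,1\}$ is the chain $0<h<1$ with $\wedge=\min$, $\vee=\max$ and unary operation $\overline0=\overline h=1$, $\overline1=h$; operations on maps into $S$ are pointwise, and $0,h,1$ also denote constant maps. $p_i:S^n\to S$ is the $i$-th projection, $p_i^{0}=p_i$ and $p_i^{1}=\overline{p_i}$. Let $r_1=S^2\setminus\{(1,0)\}$, $r_2=S^2\setminus\{(h,0),(1,0)\}$, $r_3=S^2\setminus\{(0,1),(h,1),(1,0),(1,h)\}$, and $\mathbf S=\langle S;\{r_1,r_2,r_3\},\mathcal T\rangle$ with $\mathcal T$ discrete. $\mathcal X(\mathbf S^n,\mathbf S)$ is the lattice (pointwise order) of maps $f:S^n\to S$ preserving $r_1,r_2,r_3$ (for each $k$: if $(x_i,y_i)\in r_k$ for all $i$, then $(f(x),f(y))\in r_k$), and $\mathcal X(\mathbf S^n,\mathbf S)_J$ is its set of join-irreducible elements ($f\ne0$, and $f=g\vee k$ with $g,k$ in the lattice implies $f=g$ or $f=k$). *)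

(* Defs.v *)
From mathcomp Require Import all_boot all_order.

Set Implicit Arguments.
Unset Strict Implicit.
Unset Printing Implicit Defensive.

(* The chain 0 < h < 1 is 'I_3 with the library order on ordinals: the top
   element 1 of the chain is the ordinal of value 2. *)
Notation chain := 'I_3.
Definition c0 : chain := @Ordinal 3 0 isT.
Definition ch : chain := @Ordinal 3 1 isT.
Definition c1 : chain := @Ordinal 3 2 isT.

Definition cbar (a : chain) : chain := if a == c1 then ch else c1.

Definition r1 : {set chain * chain} := ~: [set (c1, c0)].
Definition r2 : {set chain * chain} := ~: [set (ch, c0); (c1, c0)].
Definition r3 : {set chain * chain} :=
  ~: [set (c0, c1); (ch, c1); (c1, c0); (c1, ch)].

Notation point n := {ffun 'I_n -> chain}.
Notation cmap n := {ffun {ffun 'I_n -> chain} -> chain}.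

Definition mcst n (a : chain) : cmap n := [ffun=> a].
Definition mmeet n (f g : cmap n) : cmap n := [ffun x => (f x `&` g x)%O].
Definition mjoin n (f g : cmap n) : cmap n := [ffun x => (f x `|` g x)%O].
Definition mbar n (f : cmap n) : cmap n := [ffun x => cbar (f x)].
Definition mle n (f g : cmap n) : Prop := forall x : point n, (f x <= g x)%O.

Definition proj n (i : 'I_n) : cmap n := [ffun x : point n => x i].
(* The exponents 0 and 1 are the booleans false and true. *)
Definition proj_exp n (i : 'I_n) (e : bool) : cmap n :=
  if e then mbar (proj i) else proj i.
Definition meet_proj n (e : {ffun 'I_n -> bool}) : cmap n :=
  \big[@mmeet n/mcst n c1]_(i < n) proj_exp i (e i).

Definition preserves n (r : {set chain * chain}) (f : cmap n) : Prop :=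
  forall x y : point n,
    (forall i, (x i, y i) \in r) -> (f x, f y) \in r.

(* The topology being discrete, continuity imposes no condition. *)
Definition in_lattice n (f : cmap n) : Prop :=
  [/\ preserves r1 f, preserves r2 f & preserves r3 f].

(* Joins in the lattice are the pointwise joins, since r1, r2 and r3 are
   sublattices of the square of the chain. *)
Definition join_irreducible n (f : cmap n) : Prop :=
  [/\ in_lattice f,
      f <> mcst n c0
    & forall g k : cmap n, in_lattice g -> in_lattice k ->
        f = mjoin g k -> f = g \/ f = k].

(* Main.v *)
(** A map [f] preserving r1, r2, r3 is encoded by a pair of families of subsets
    of the index set: [A], the sets [{i | x i = 1}] of the points with
    [f x = 1] (r3 makes [f x = 1] depend only on this set), and [B], the
    supports of the points with [f x <> 0], which r2 makes upward closed; r1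
    amounts to [A] being contained in [B].  Joins are unions, so the
    join-irreducible pairs are [({T}, up T)] and [(set0, up T)]; with [e] the
    indicator of the complement of [T], these are the meet of the
    [p_i^(e i)] and its meet with [h]. *)
Require Import Defs.
From mathcomp Require Import all_boot all_order.

Lemma chainP (a : chain) : [\/ a = c0, a = ch | a = c1].
Proof.
by case: a => [[|[|[|m]]]] // lt_m3;
  [apply: Or31 | apply: Or32 | apply: Or33]; apply: val_inj.
Qed.

(** Maps are compared below through their zero sets and their one-sets separately; [ch] is the only
    value failing both tests. *)
Lemma eq_chain (a b : chain) :
  (a == c0) = (b == c0) -> (a == c1) = (b == c1) -> a = b.
Proof. by case: (chainP a) => ->; case: (chainP b) => ->. Qed.

Lemma cbar_eq0 a : (cbar a == c0) = false.
Proof. by case: (chainP a) => ->. Qed.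

Lemma cbar_eq1 a : (cbar a == c1) = (a != c1).
Proof. by case: (chainP a) => ->. Qed.

Lemma meet_eq0 (a b : chain) : ((a `&` b)%O == c0) = (a == c0) || (b == c0).
Proof. by case: (chainP a) => ->; case: (chainP b) => ->. Qed.

Lemma meet_eq1 (a b : chain) : ((a `&` b)%O == c1) = (a == c1) && (b == c1).
Proof. by case: (chainP a) => ->; case: (chainP b) => ->. Qed.

Lemma join_eq0 (a b : chain) : ((a `|` b)%O == c0) = (a == c0) && (b == c0).
Proof. by case: (chainP a) => ->; case: (chainP b) => ->. Qed.

Lemma join_eq1 (a b : chain) : ((a `|` b)%O == c1) = (a == c1) || (b == c1).
Proof. by case: (chainP a) => ->; case: (chainP b) => ->. Qed.

Lemma le_ch (a : chain) : (a <= ch)%O = (a != c1).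
Proof. by case: (chainP a) => ->. Qed.

Lemma in_r1 a b : ((a, b) \in r1) = ((a == c1) ==> (b != c0)).
Proof. by rewrite !inE; case: (chainP a) => ->; case: (chainP b) => ->. Qed.

Lemma in_r2 a b : ((a, b) \in r2) = ((b == c0) ==> (a == c0)).
Proof. by rewrite !inE; case: (chainP a) => ->; case: (chainP b) => ->. Qed.

Lemma in_r3 a b : ((a, b) \in r3) = ((a == c1) == (b == c1)).
Proof. by rewrite !inE; case: (chainP a) => ->; case: (chainP b) => ->. Qed.

(** Each relation only involves the tests [== c0] and [== c1], so membership becomes a condition on
    the zero set and the one-set of [f]. The second clause says that the supports form an upward
    closed family. *)
Lemma in_latticeP n (f : cmap n) :
  in_lattice f <->
  [/\ forall x y : point n, (forall i, x i == c1 -> y i != c0) ->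
        f x == c1 -> f y != c0,
      forall x y : point n, (forall i, y i == c0 -> x i == c0) ->
        f y == c0 -> f x == c0
    & forall x y : point n, (forall i, (x i == c1) = (y i == c1)) ->
        (f x == c1) = (f y == c1)].
Proof.
split=> -[f1 f2 f3]; split=> x y xy.
- apply/implyP; rewrite -in_r1; apply: f1 => i; rewrite in_r1.
  exact/implyP/xy.
- apply/implyP; rewrite -in_r2; apply: f2 => i; rewrite in_r2.
  exact/implyP/xy.
- have: (f x, f y) \in r3 by apply: f3 => i; rewrite in_r3 xy.
  by rewrite in_r3 => /eqP.
- rewrite in_r1; apply/implyP; apply: f1 => i.
  by apply/implyP; rewrite -in_r1.
- rewrite in_r2; apply/implyP; apply: f2 => i.
  by apply/implyP; rewrite -in_r2.
- rewrite in_r3; apply/eqP; apply: f3 => i.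
  by have := xy i; rewrite in_r3 => /eqP.
Qed.

Lemma big_mmeetE n (I : Type) (r : seq I) (F : I -> cmap n) (x : point n) :
  (\big[@mmeet n/mcst n c1]_(i <- r) F i) x =
  \big[Order.meet/c1]_(i <- r) F i x.
Proof.
by elim/big_rec2: _ => [|i a f _ <-]; rewrite ffunE.
Qed.

(** Only the indices with [e i] false can produce a zero, since [cbar] never takes the value 0. *)
Lemma meet_proj_eq0 n (e : {ffun 'I_n -> bool}) (x : point n) :
  (meet_proj e x == c0) = [exists i, ~~ e i && (x i == c0)].
Proof.
rewrite big_mmeetE (big_morph (fun a => a == c0) (id1 := false) (op1 := orb)) //.
  rewrite big_orE; apply: eq_existsb => i.
  by rewrite /proj_exp; case: (e i); rewrite !ffunE ?cbar_eq0.
exact: meet_eq0.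
Qed.

Lemma meet_proj_eq1 n (e : {ffun 'I_n -> bool}) (x : point n) :
  (meet_proj e x == c1) = [forall i, (x i == c1) == ~~ e i].
Proof.
rewrite big_mmeetE (big_morph (fun a => a == c1) (id1 := true) (op1 := andb)) //.
  rewrite big_andE; apply: eq_forallb => i.
  by rewrite /proj_exp; case: (e i); rewrite !ffunE ?cbar_eq1; case: eqP.
exact: meet_eq1.
Qed.

Lemma in_lattice_meet_proj n (e : {ffun 'I_n -> bool}) :
  in_lattice (meet_proj e).
Proof.
apply/in_latticeP; split=> x y xy.
- rewrite meet_proj_eq1 meet_proj_eq0 => /forallP x1.
  apply/existsPn => i; apply/nandP; case: (boolP (e i)) => ei; first by left.
  by right; apply: xy; rewrite (eqP (x1 i)).
- rewrite !meet_proj_eq0 => /existsP [i /andP [ei yi]].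
  by apply/existsP; exists i; rewrite ei xy.
- by rewrite !meet_proj_eq1; apply: eq_forallb => i; rewrite xy.
Qed.

Lemma mmeet_h_eq0 n (f : cmap n) x : (mmeet f (mcst n ch) x == c0) = (f x == c0).
Proof. by rewrite !ffunE meet_eq0 orbF. Qed.

Lemma mmeet_h_eq1 n (f : cmap n) x : (mmeet f (mcst n ch) x == c1) = false.
Proof. by rewrite !ffunE meet_eq1 andbF. Qed.

(** Meeting with [h] empties the one-set, which settles r1 and r3, and keeps the zero set, to which
    r2 refers. *)
Lemma in_lattice_mmeet_h n (f : cmap n) :
  in_lattice f -> in_lattice (mmeet f (mcst n ch)).
Proof.
move=> /in_latticeP [_ f2 _]; apply/in_latticeP; split=> x y xy.
- by rewrite mmeet_h_eq1.
- by rewrite !mmeet_h_eq0; apply: f2.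
- by rewrite !mmeet_h_eq1.
Qed.

(** The zero set survives the meet with [h] and already determines [e]. This yields both uniqueness
    claims, as equal meets of projections stay equal after meeting with [h]. *)
Lemma meet_proj_h_inj n :
  injective (fun e : {ffun 'I_n -> bool} => mmeet (meet_proj e) (mcst n ch)).
Proof.
have sub (e e' : {ffun 'I_n -> bool}) :
    mmeet (meet_proj e) (mcst n ch) = mmeet (meet_proj e') (mcst n ch) ->
    forall i, e i -> e' i.
  move=> ee' i ei; apply: contraT => e'i.
  (* This point vanishes exactly where [e] holds: it makes [meet_proj e] nonzero, but [meet_proj e']
     zero because of the index [i]. *)
  pose x : point n := [ffun j => if e j then c0 else c1].
  have : meet_proj e' x == c0.
    by rewrite meet_proj_eq0; apply/existsP; exists i; rewrite e'i ffunE ei.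
  rewrite -mmeet_h_eq0 -ee' mmeet_h_eq0 meet_proj_eq0 => /existsP [j].
  by rewrite ffunE; case: (e j).
move=> e e' ee'; apply/ffunP => i.
by apply/idP/idP; apply: sub.
Qed.

Lemma join_irreducible_split n (f g k : cmap n) (x : point n) :
  join_irreducible f -> in_lattice g -> in_lattice k ->
  f = mjoin g k -> k x <> f x -> f = g.
Proof.
by move=> [_ _ irr] Lg Lk fgk kx; case: (irr g k Lg Lk fgk) => // fk;
  case: kx; rewrite -fk.
Qed.

(** Take [x] with [f x = 1]. Lowering [f] to [h] at the points with the same one-coordinates as [x]
    gives [k]; joining [meet_proj e] restores the value 1 exactly there. As [k] differs from [f] at
    [x], irreducibility leaves [meet_proj e]. *)
Lemma join_irreducible_nle_h n (f : cmap n) :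
  join_irreducible f -> ~ mle f (mcst n ch) ->
  exists e : {ffun 'I_n -> bool}, f = meet_proj e.
Proof.
move=> Jf nle; have [Lf _ _] := Jf.
have /in_latticeP [f1 f2 f3] := Lf.
have [x fx] : exists x, f x == c1.
  apply/existsP; apply: contra_notT nle => /existsPn nf x.
  by rewrite ffunE le_ch.
pose e : {ffun 'I_n -> bool} := [ffun i => x i != c1].
(* [k] removes the set [{i | x i = 1}] from the family A. *)
pose k : cmap n :=
  [ffun y : point n =>
     if [forall i, (y i == c1) == (x i == c1)] then (ch `&` f y)%O else f y].
have k0 (y : point n) : (k y == c0) = (f y == c0).
  by rewrite ffunE; case: ifP; rewrite ?meet_eq0.
have k1 (y : point n) :
    (k y == c1) = ~~ [forall i, (y i == c1) == (x i == c1)] && (f y == c1).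
  by rewrite ffunE; case: ifP; rewrite ?meet_eq1.
have e1 (y : point n) :
    (meet_proj e y == c1) = [forall i, (y i == c1) == (x i == c1)].
  by rewrite meet_proj_eq1; apply: eq_forallb => i; rewrite ffunE negbK.
exists e; apply: (@join_irreducible_split _ f (meet_proj e) k x) => //.
- exact: in_lattice_meet_proj.
- apply/in_latticeP; split=> y z yz.
  + by rewrite k1 k0 => /andP [_]; apply: f1.
  + by rewrite !k0; apply: f2.
  + rewrite !k1 (f3 _ _ yz); congr (~~ _ && _).
    by apply: eq_forallb => i; rewrite yz.
- apply/ffunP => y; rewrite [RHS]ffunE; apply: eq_chain.
  + rewrite join_eq0 k0; case: (boolP (f y == c0)) => fy; rewrite ?andbF //.
    (* The join adds nothing to the support: where [meet_proj e] is nonzero, [y] is nonzero at every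
       one-coordinate of [x], so r1 and [f x = 1] give [f y] nonzero. *)
    rewrite andbT; apply/esym; apply: contraLR fy; rewrite meet_proj_eq0.
    move=> /existsPn ey; apply: f1 fx => i xi.
    by move: (ey i); rewrite ffunE xi.
  + rewrite join_eq1 k1 e1; case: (boolP [forall i, _]) => //= /forallP yx.
    by rewrite (f3 y x) ?fx // => i; exact: eqP (yx i).
- move=> kx; move: (k1 x); rewrite kx fx.
  by case: forallP => // -[] i.
Qed.

(** Now [f] only takes the values 0 and [h], so its family of supports determines it. Deleting one
    member gives [k], and the map to [h] supported on all points above that member puts it back. *)
Lemma join_irreducible_le_h n (f : cmap n) :
  join_irreducible f -> mle f (mcst n ch) ->
  exists e : {ffun 'I_n -> bool}, f = mmeet (meet_proj e) (mcst n ch).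
Proof.
move=> Jf le_fh; have [Lf f_neq0 _] := Jf.
have /in_latticeP [_ f2 _] := Lf.
have nf1 (x : point n) : (f x == c1) = false.
  by apply: negbTE; rewrite -le_ch; move: (le_fh x); rewrite ffunE.
pose supp (x : point n) := [set i | x i != c0].
have [x0 fx0] : exists x, f x != c0.
  apply/existsP; apply: contra_notT f_neq0 => /existsPn nf.
  by apply/ffunP => x; rewrite ffunE; apply/eqP; rewrite -[_ == _]negbK.
(* Minimal cardinality keeps the family upward closed after the deletion: a member contained in
   [supp x] must equal it. *)
have [x fx min_x] :=
  @arg_minnP _ x0 (fun x => f x != c0) (fun x => #|supp x|) fx0.
pose e : {ffun 'I_n -> bool} := [ffun i => x i == c0].
(* [k] removes the minimal support [supp x] from the family B. *)
pose k : cmap n := [ffun y : point n => if supp y == supp x then c0 else f y].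
have k0 (y : point n) : (k y == c0) = (supp y == supp x) || (f y == c0).
  by rewrite ffunE; case: ifP.
have k1 (y : point n) : (k y == c1) = false by rewrite ffunE; case: ifP.
have e0 (y : point n) : (meet_proj e y == c0) = ~~ (supp x \subset supp y).
  rewrite meet_proj_eq0; apply/existsP/subsetPn => [[i]|[i]].
    by rewrite ffunE => /andP [xi yi]; exists i; rewrite inE ?negbK.
  by rewrite !inE negbK => xi yi; exists i; rewrite ffunE xi.
have supp_le (y z : point n) : supp y \subset supp z -> f z == c0 -> f y == c0.
  move=> /subsetP yz; apply: f2 => i.
  by move: (yz i); rewrite !inE; do 2!case: eqP => // _; move/(_ isT).
exists e; apply: (@join_irreducible_split _ f _ k x) => //.
- exact/in_lattice_mmeet_h/in_lattice_meet_proj.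
- apply/in_latticeP; split=> y z yz; rewrite ?k1 //.
  have yz' : supp y \subset supp z.
    by apply/subsetP => i; rewrite !inE; apply/contra/yz.
  rewrite !k0 => /orP [/eqP zx|fz]; last by rewrite (supp_le _ _ yz') ?orbT.
  case: (boolP (f y == c0)) => fy; rewrite ?orbT // orbF.
  by rewrite eqEcard -zx yz' zx min_x.
- apply/ffunP => y; rewrite [RHS]ffunE; apply: eq_chain.
  + rewrite join_eq0 mmeet_h_eq0 k0 e0.
    case: (boolP (f y == c0)) => fy; rewrite ?orbT ?orbF ?andbT.
      by apply/esym; apply: contra fx => xy; apply: supp_le fy.
    by case: (eqVneq (supp y) (supp x)) => [->|_]; rewrite ?subxx ?andbF.
  + by rewrite join_eq1 mmeet_h_eq1 k1 nf1.
- by move=> kx; move: (k0 x); rewrite kx eqxx (negbTE fx).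
Qed.

Theorem theorem5 (n : nat) (n_ge1 : 1 <= n) (Phi : cmap n)
    (Phi_J : join_irreducible Phi) :
  (~ mle Phi (mcst n ch) ->
     exists! e : {ffun 'I_n -> bool}, Phi = meet_proj e) /\
  (mle Phi (mcst n ch) ->
     exists! e : {ffun 'I_n -> bool}, Phi = mmeet (meet_proj e) (mcst n ch)).
Proof.
split=> Phi_h.
  have [e De] := join_irreducible_nle_h _ _ Phi_J Phi_h.
  by exists e; split=> // e' De'; apply: meet_proj_h_inj; rewrite -De -De'.
have [e De] := join_irreducible_le_h _ _ Phi_J Phi_h.
by exists e; split=> // e' De'; apply: meet_proj_h_inj; rewrite -De -De'.
Qed.
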